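(* Let $\ell,k$ be positive integers and let $\lambda=[(k2^\ell)^{2^\ell},((k-1)2^\ell)^{2^\ell},\ldots,(2^\ell)^{2^\ell}]$ be the generalized staircase with $r=c=2^\ell$. For integers $i,j\ge0$ with $0\le\lfloor i/2^\ell\rfloor+\lfloor j/2^\ell\rfloor\le k-1$, let $f(i,j)=k-1-\lfloor i/2^\ell\rfloor-\lfloor j/2^\ell\rfloor$, and let $\mathrm{SG}(\mu)$ denote the Sprague-Grundy value of $\mu$ in the game Rook. Then for all such $i,j$, $$\mathrm{SG}(\lambda[i,j])=2^\ell f(i,j)+\Big(\big((-i-1)\oplus(-j-1)\big)\bmod 2^\ell\Big).$$ Furthermore, let $\tau\in\{0,\ldots,k-1\}$ and fix any integer $i$ with $0\le i\le (k-\tau)2^\ell-1$. For $0\le t\le\tau$ let $S_t=\{\mathrm{SG}(\lambda[i,j]) : j\ge 0,\ f(i,j)=t\}$. Then $$S_\tau=\{\tau2^\ell,\tau 2^\ell+1,\ldots,(\tau+1)2^\ell-1\}\quad\text{and}\quad \bigcup_{t=0}^{\tau}S_t=\{0,1,\ldots,(\tau+1)2^\ell-1\}.$$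
   Context: A partition is a finite weakly decreasing sequence $\lambda=[\lambda_1,\ldots,\lambda_s]$ of positive integers (exponents outside a part denote repetition, so $[(k2^\ell)^{2^\ell},\ldots]$ has the part $k2^\ell$ repeated $2^\ell$ times, etc.; $[\,]$ is the empty partition). For $i,j\ge 0$, $\lambda[i,j]=[\lambda_{i+1}-j,\lambda_{i+2}-j,\ldots]$ with trailing nonpositive entries removed. Rook is the impartial game whose positions are nonempty partitions; from $\mu$ a player may move to $\mu[a,b]$ for any $(a,b)\in\{(m,0):m\ge1\}\cup\{(0,m):m\ge1\}$ with $\mu[a,b]\ne[\,]$. The Sprague-Grundy value of a position is the mex (least nonnegative integer not in the set) of the Sprague-Grundy values of the positions reachable in one move. $\oplus$ is bitwise XOR (nim-sum); for negative integers it is taken in two's complement, so that $((-i-1)\oplus(-j-1))\bmod 2^\ell=((-i-1)\bmod 2^\ell)\oplus((-j-1)\bmod 2^\ell)$, with residues in $\{0,\ldots,2^\ell-1\}$. *)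

(* Defs.v *)
From Stdlib Require Import ZArith Arith Lia List Sorted.
Import ListNotations.

Definition is_partition (mu : list nat) : Prop :=
  Sorted ge mu /\ Forall (fun x => 0 < x) mu.

(** [cut mu i j] is [mu[i,j]].  Subtraction on [nat] truncates, so the
    nonpositive entries are the ones that become [0]; in a weakly decreasing
    list they are all trailing, hence filtering removes exactly those. *)
Definition cut (mu : list nat) (i j : nat) : list nat :=
  filter (fun x => 0 <? x) (map (fun x => x - j) (skipn i mu)).

Definition rook_move (mu nu : list nat) : Prop :=
  nu <> [] /\ exists m, 1 <= m /\ (nu = cut mu m 0 \/ nu = cut mu 0 m).

(** [[(k c)^r, ((k-1) c)^r, ..., c^r]] *)
Fixpoint staircase (k r c : nat) : list nat :=
  match k with
  | 0 => []
  | S k' => repeat (k * c) r ++ staircase k' r c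
  end.

(** The moves as a finite list: beyond these bounds on [m] the result is
    empty, see [In_rook_options]. *)
Definition rook_options (mu : list nat) : list (list nat) :=
  filter (fun nu => match nu with [] => false | _ => true end)
    (map (fun m => cut mu m 0) (seq 1 (length mu)) ++
     map (fun m => cut mu 0 m) (seq 1 (list_max mu))).

Definition is_mex (A : nat -> Prop) (g : nat) : Prop :=
  ~ A g /\ forall n, n < g -> A n.

Definition mex (s : list nat) : nat :=
  match find (fun n => negb (existsb (Nat.eqb n) s)) (seq 0 (S (length s))) with
  | Some n => n
  | None => 0
  end.

Fixpoint SG_rec (fuel : nat) (mu : list nat) : nat :=
  match fuel with
  | 0 => 0
  | S fuel' => mex (map (SG_rec fuel') (rook_options mu))
  end.

(** The fuel bounds the length of any play from [mu]; [SG_mex] below is the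
    defining recursion.  The empty list is not a position, its value is junk. *)
Definition SG (mu : list nat) : nat := SG_rec (length mu + list_sum mu) mu.

Definition level (l k i j : nat) : Z :=
  Z.of_nat k - 1 - Z.of_nat i / 2 ^ Z.of_nat l - Z.of_nat j / 2 ^ Z.of_nat l.

(** [g] belongs to the set [S_t], for the row index [i]. *)
Definition level_values (l k i t g : nat) : Prop :=
  exists j, level l k i j = Z.of_nat t /\
    SG (cut (staircase k (2 ^ l) (2 ^ l)) i j) = g.

Lemma find_seq_min (p : nat -> bool) a n x :
  find p (seq a n) = Some x ->
  p x = true /\ a <= x /\ forall y, a <= y < x -> p y = false.
Proof.
revert a; induction n as [|n IH]; intros a; simpl; [discriminate|].
destruct (p a) eqn:E.
- intros [= <-]; repeat split; auto; intros; lia.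
- intros H; apply IH in H as (H1 & H2 & H3); repeat split; auto; [lia|].
  intros y Hy; destruct (Nat.eq_dec y a) as [->|]; auto; apply H3; lia.
Qed.

Lemma existsb_eqb_In n s : existsb (Nat.eqb n) s = true <-> In n s.
Proof.
rewrite existsb_exists; split.
- intros (x & Hx & E); apply Nat.eqb_eq in E; now subst.
- intros H; exists n; split; auto; apply Nat.eqb_refl.
Qed.

Lemma mexP s : is_mex (fun n => In n s) (mex s).
Proof.
unfold mex; destruct find as [x|] eqn:E.
- apply find_seq_min in E as (H1 & _ & H3); split.
  + rewrite <- existsb_eqb_In; destruct existsb; easy.
  + intros n Hn; apply existsb_eqb_In, Bool.negb_false_iff, (H3 n); lia.
- exfalso.
  assert (L : length (seq 0 (S (length s))) <= length s).
  { apply NoDup_incl_length; [apply seq_NoDup|].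
    intros x Hx; apply existsb_eqb_In.
    apply (find_none _ _ E) in Hx; now destruct existsb. }
  rewrite length_seq in L; lia.
Qed.

Lemma mex_unique A g h : is_mex A g -> is_mex A h -> g = h.
Proof.
intros [H1 H2] [H3 H4]; destruct (lt_eq_lt_dec g h) as [[L|E]|L]; auto.
- now destruct (H1 (H4 _ L)).
- now destruct (H3 (H2 _ L)).
Qed.

Lemma In_rook_options mu nu : In nu (rook_options mu) <-> rook_move mu nu.
Proof.
unfold rook_options, rook_move; rewrite filter_In, in_app_iff, !in_map_iff.
split.
- intros [[(m & <- & Hm)|(m & <- & Hm)] Hn]; apply in_seq in Hm;
    (split; [intros E; now rewrite E in Hn|]); exists m; (split; [lia|auto]).
- intros [Hn (m & Hm & E)]; split; [|now destruct nu].
  destruct E as [->| ->].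
  + left; exists m; split; auto; apply in_seq.
    destruct (le_lt_dec m (length mu)); [lia|].
    destruct Hn; unfold cut; now rewrite skipn_all2 by lia.
  + right; exists m; split; auto; apply in_seq.
    destruct (le_lt_dec m (list_max mu)) as [|L]; [lia|].
    destruct Hn; unfold cut; simpl.
    assert (F : Forall (fun x => x <= m) mu) by (apply list_max_le; lia).
    clear -F; induction F as [|x s Hx _ IH]; simpl; auto.
    now replace (x - m) with 0 by lia.
Qed.

Lemma length_cut mu i j : length (cut mu i j) <= length mu - i.
Proof.
unfold cut; rewrite filter_length_le, length_map, length_skipn; lia.
Qed.

Lemma sum_cut mu i j : list_sum (cut mu i j) <= list_sum mu.
Proof.
unfold cut; revert i; induction mu as [|x mu IH]; intros [|i]; simpl; auto.
- specialize (IH 0); simpl in IH; destruct (0 <? x - j); simpl; lia.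
- specialize (IH i); lia.
Qed.

Lemma sum_cut_lt mu j :
  1 <= j -> cut mu 0 j <> [] -> list_sum (cut mu 0 j) < list_sum mu.
Proof.
intros Hj; induction mu as [|x mu IH]; [easy|].
assert (D := sum_cut mu 0 j); unfold cut in *; simpl in *.
destruct (Nat.ltb_spec 0 (x - j)); simpl; intros Hn.
- lia.
- specialize (IH Hn); lia.
Qed.

Lemma rook_move_lt mu nu : rook_move mu nu ->
  length nu + list_sum nu < length mu + list_sum mu.
Proof.
intros [Hn (m & Hm & [->| ->])].
- assert (length (cut mu m 0) <> 0) by (now destruct (cut mu m 0)).
  pose proof (length_cut mu m 0); pose proof (sum_cut mu m 0); lia.
- pose proof (length_cut mu 0 m); pose proof (sum_cut_lt mu m Hm Hn); lia.
Qed.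

Lemma SG_rec_enough mu : forall n n',
  length mu + list_sum mu <= n -> length mu + list_sum mu <= n' ->
  SG_rec n mu = SG_rec n' mu.
Proof.
remember (length mu + list_sum mu) as w eqn:Ew; revert mu Ew.
induction w as [w IH] using lt_wf_ind; intros mu -> n n' Hn Hn'.
destruct (Nat.eq_dec (length mu) 0) as [E|E].
{ destruct mu; [|easy]; destruct n, n'; reflexivity. }
destruct n as [|n]; [lia|]; destruct n' as [|n']; [lia|]; simpl.
f_equal; apply map_ext_in; intros nu H.
apply In_rook_options, rook_move_lt in H.
apply (IH _ H nu eq_refl); lia.
Qed.

Lemma SG_mex mu :
  is_mex (fun g => exists nu, rook_move mu nu /\ SG nu = g) (SG mu).
Proof.
assert (E : SG mu = mex (map SG (rook_options mu))).
{ unfold SG at 1.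
  rewrite (SG_rec_enough mu _ (S (length mu + list_sum mu))) by lia.
  simpl; f_equal; apply map_ext_in; intros nu H.
  apply In_rook_options, rook_move_lt in H.
  apply SG_rec_enough; lia. }
rewrite E; destruct (mexP (map SG (rook_options mu))) as [H1 H2]; split.
- intros (nu & Hm & Hg); apply H1; rewrite <- Hg.
  now apply in_map, In_rook_options.
- intros n Hn; apply H2, in_map_iff in Hn as (nu & <- & Hn).
  exists nu; split; auto; now apply In_rook_options.
Qed.

Lemma is_partition_cut mu i j : is_partition mu -> is_partition (cut mu i j).
Proof.
intros [Hs _]; split.
- apply Sorted_StronglySorted in Hs; [|intros x y z; lia].
  apply StronglySorted_Sorted; unfold cut.
  revert i; induction Hs as [|x s Hs IH Hx]; intros i.
  { rewrite skipn_nil; constructor. }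
  destruct i as [|i]; [|apply IH].
  specialize (IH 0); simpl in *; destruct (0 <? x - j); auto.
  constructor; auto; apply Forall_forall; intros y Hy.
  apply filter_In in Hy as [Hy _]; apply in_map_iff in Hy as (z & <- & Hz).
  rewrite Forall_forall in Hx; specialize (Hx _ Hz); lia.
- apply Forall_forall; intros y Hy; unfold cut in Hy.
  apply filter_In in Hy as [_ Hy]; now apply Nat.ltb_lt.
Qed.

Lemma staircase_bound k r c :
  0 < c -> Forall (fun x => 0 < x <= k * c) (staircase k r c).
Proof.
intros Hc; induction k as [|k IH]; [constructor|].
apply Forall_app; split.
- apply Forall_forall; intros x Hx; apply repeat_spec in Hx; nia.
- eapply Forall_impl; [|exact IH]; simpl; lia.
Qed.

Lemma is_partition_staircase k r c : 0 < c -> is_partition (staircase k r c).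
Proof.
intros Hc; split.
- apply StronglySorted_Sorted; induction k as [|k IH]; [constructor|].
  cbn [staircase].
  assert (G : forall n, StronglySorted ge (repeat (S k * c) n ++ staircase k r c)).
  { induction n as [|n IHn]; simpl; auto.
    constructor; auto; apply Forall_app; split; apply Forall_forall; intros x Hx.
    - apply repeat_spec in Hx; lia.
    - pose proof (staircase_bound k r c Hc) as B.
      rewrite Forall_forall in B; apply B in Hx; lia. }
  apply G.
- eapply Forall_impl; [|exact (staircase_bound k r c Hc)]; simpl; lia.
Qed.

(* Main.v *)
Require Import Defs.
From Stdlib Require Import ZArith Arith Lia List Sorted.
Import ListNotations.

(** Since the staircase is made of [2^l] by [2^l] blocks, a position [lambda[i,j]]
    is nonempty iff [i/2^l + j/2^l < k], so Rook on it is played with a single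
    rook at [(i,j)].  A move that leaves the block decreases the level, and every
    value of a lower level is reached along the row, because XOR with a fixed
    residue permutes the residues.  A move that stays in the block decreases one
    of the two complemented residues, as in Nim with two heaps. *)

(** * Moves as increments of the index pair [(i, j)] *)

(** In a weakly decreasing list the entries removed by filtering form a suffix, so filtering
    commutes with skipping the first [m] entries. *)
Lemma cut_row_move mu i j m :
  is_partition mu -> cut (cut mu i j) m 0 = cut mu (i + m) j.
Proof.
intros [Hs _]; apply Sorted_StronglySorted in Hs; [|intros x y z; lia].
revert i m; induction Hs as [|x s Hs IH Hx]; intros i m.
{ destruct i, m; reflexivity. }
destruct i as [|i]; [|exact (IH i m)].
specialize (IH 0); unfold cut in *; simpl in *.
destruct (Nat.ltb_spec 0 (x - j)) as [H|H].
- destruct m as [|m]; simpl; [|exact (IH m)].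
  specialize (IH 0); simpl in IH; rewrite IH, Nat.sub_0_r.
  destruct (Nat.ltb_spec 0 (x - j)); [easy|lia].
(* Once the head drops to [0], so does every later entry, and both sides are empty. *)
- assert (E : forall n, filter (fun y => 0 <? y)
                    (map (fun y => y - j) (skipn n s)) = []).
  { intros n; revert Hx; clear -H; revert n.
    induction s as [|y s IH]; intros n Hx; [now rewrite skipn_nil|].
    inversion_clear Hx as [|? ? Hy Hs].
    destruct n as [|n]; simpl; [|now apply IH].
    specialize (IH 0 Hs); simpl in IH; rewrite IH.
    destruct (Nat.ltb_spec 0 (y - j)); [lia|easy]. }
  pose proof (E 0) as E0; simpl in E0; rewrite E0, skipn_nil.
  destruct m as [|m]; simpl; [|now rewrite E].
  rewrite E0; destruct (Nat.ltb_spec 0 (x - j)); [lia|easy].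
Qed.

Lemma cut_column_move mu i j m : cut (cut mu i j) 0 m = cut mu i (j + m).
Proof.
unfold cut; simpl; induction (skipn i mu) as [|x s IH]; simpl; auto.
destruct (Nat.ltb_spec 0 (x - j)); simpl; rewrite IH; rewrite ?Nat.sub_add_distr.
- easy.
- destruct (Nat.ltb_spec 0 (x - j - m)); [lia|easy].
Qed.

Lemma cut_nonempty mu i j :
  is_partition mu -> cut mu i j <> [] <-> j < nth i mu 0.
Proof.
intros [Hs _]; apply Sorted_StronglySorted in Hs; [|intros x y z; lia].
revert i; induction Hs as [|x s Hs IH Hx]; intros i.
{ unfold cut; rewrite skipn_nil; destruct i; simpl; split; [easy|lia|easy|lia]. }
destruct i as [|i]; [|exact (IH i)].
specialize (IH 0); unfold cut in *; simpl in *.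
destruct (Nat.ltb_spec 0 (x - j)); [split; [lia|easy]|].
rewrite IH; destruct s as [|y s]; simpl; [lia|].
inversion_clear Hx; lia.
Qed.

(** Past the end of the list, the default [0] of [nth] agrees with the truncated [k - i / r]. *)
Lemma nth_staircase k r c i :
  0 < r -> nth i (staircase k r c) 0 = (k - i / r) * c.
Proof.
intros Hr; revert i; induction k as [|k IH]; intros i.
{ now destruct i. }
cbn [staircase]; destruct (le_lt_dec r i) as [L|L].
- rewrite app_nth2; rewrite repeat_length; [|lia].
  rewrite IH; replace i with (i - r + 1 * r) at 2 by lia.
  rewrite Nat.div_add by lia; f_equal; lia.
- rewrite app_nth1 by (rewrite repeat_length; lia).
  rewrite nth_repeat_lt by lia; rewrite Nat.div_small by lia; f_equal; lia.
Qed.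

Lemma cut_staircase_nonempty k q i j :
  0 < q -> cut (staircase k q q) i j <> [] <-> i / q + j / q < k.
Proof.
intros Hq; rewrite cut_nonempty by now apply is_partition_staircase.
rewrite nth_staircase by easy.
pose proof (Nat.div_mod j q); pose proof (Nat.mod_upper_bound j q).
split; intros; nia.
Qed.

Lemma rook_move_cut_staircase k q i j nu : 0 < q ->
  rook_move (cut (staircase k q q) i j) nu <->
  exists i' j', nu = cut (staircase k q q) i' j' /\ i' / q + j' / q < k /\
    (i < i' /\ j' = j \/ i' = i /\ j < j').
Proof.
intros Hq; unfold rook_move; split.
- intros [Hn (m & Hm & [->| ->])].
  + rewrite cut_row_move in * by now apply is_partition_staircase.
    exists (i + m), j; rewrite cut_staircase_nonempty in Hn by easy; repeat split; lia.
  + rewrite cut_column_move in *.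
    exists i, (j + m); rewrite cut_staircase_nonempty in Hn by easy; repeat split; lia.
- intros (i' & j' & -> & H & H'); split; [now apply cut_staircase_nonempty|].
  destruct H' as [[L ->]|[-> L]].
  + exists (i' - i); split; [lia|left].
    rewrite cut_row_move by (now apply is_partition_staircase); f_equal; lia.
  + exists (j' - j); split; [lia|right].
    rewrite cut_column_move; f_equal; lia.
Qed.

(** * XOR and complemented residues *)

Lemma lxor_double a b e f :
  Nat.lxor (2 * a + Nat.b2n e) (2 * b + Nat.b2n f) =
  2 * Nat.lxor a b + Nat.b2n (xorb e f).
Proof.
apply Nat.bits_inj; intros [|n]; rewrite Nat.lxor_spec.
- now rewrite !Nat.testbit_0_r.
- now rewrite !Nat.testbit_succ_r, Nat.lxor_spec.
Qed.

Lemma lxor_cancel a b : Nat.lxor a (Nat.lxor a b) = b.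
Proof. now rewrite <- Nat.lxor_assoc, Nat.lxor_nilpotent, Nat.lxor_0_l. Qed.

(** The winning-move argument of two-heap Nim with an extra heap [u]. *)
Lemma lt_lxor_cases u a b :
  u < Nat.lxor a b -> Nat.lxor u b < a \/ Nat.lxor a u < b.
Proof.
revert u b; induction a as [a IH] using lt_wf_ind; intros u b H.
destruct (Nat.eq_dec a 0) as [->|Ha].
{ right; now rewrite Nat.lxor_0_l in *. }
destruct (Nat.exists_div2 a) as (a' & e & ->).
destruct (Nat.exists_div2 b) as (b' & f & ->).
destruct (Nat.exists_div2 u) as (u' & g & ->).
rewrite lxor_double in *; rewrite lxor_double.
destruct (lt_eq_lt_dec u' (Nat.lxor a' b')) as [[L|E]|L].
- assert (La : a' < 2 * a' + Nat.b2n e) by lia.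
  destruct (IH a' La u' b' L); [left|right]; destruct e, f, g; simpl in *; lia.
(* The higher bits agree, so the lowest bits decide: [g] is [false] and exactly one of [e], [f] is
   [true], which tells the heap to lower. *)
- assert (E1 : Nat.lxor u' b' = a').
  { now rewrite E, Nat.lxor_assoc, Nat.lxor_nilpotent, Nat.lxor_0_r. }
  assert (E2 : Nat.lxor a' u' = b') by (rewrite E; apply lxor_cancel).
  rewrite E1, E2; destruct e, f, g; simpl in *; lia.
- exfalso; destruct e, f, g; simpl in *; lia.
Qed.

(** Reduction modulo [2^l] keeps the lowest [l] bits, in two's complement also for negative
    integers, and XOR acts bit by bit. *)
Lemma lxor_mod_pow2 a b l :
  (Z.lxor a b mod 2 ^ Z.of_nat l =
   Z.lxor (a mod 2 ^ Z.of_nat l) (b mod 2 ^ Z.of_nat l))%Z.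
Proof.
apply Z.bits_inj'; intros n Hn; rewrite Z.lxor_spec.
destruct (Z.lt_ge_cases n (Z.of_nat l)).
- rewrite !Z.mod_pow2_bits_low by easy; apply Z.lxor_spec.
- now rewrite !Z.mod_pow2_bits_high by lia.
Qed.

Lemma testbit_of_nat a n :
  Z.testbit (Z.of_nat a) (Z.of_nat n) = Nat.testbit a n.
Proof.
revert a; induction n as [|n IH]; intros a;
  destruct (Nat.exists_div2 a) as (a' & e & ->);
  replace (Z.of_nat (2 * a' + Nat.b2n e)) with (2 * Z.of_nat a' + Z.b2z e)%Z
    by (destruct e; simpl Nat.b2n; simpl Z.b2z; lia).
- rewrite Nat.testbit_0_r; apply Z.testbit_0_r.
- rewrite Nat.testbit_succ_r, Nat2Z.inj_succ, Z.testbit_succ_r by lia; apply IH.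
Qed.

Lemma of_nat_lxor a b :
  Z.of_nat (Nat.lxor a b) = Z.lxor (Z.of_nat a) (Z.of_nat b).
Proof.
apply Z.bits_inj'; intros n Hn; rewrite Z.lxor_spec.
rewrite <- (Z2Nat.id n) by easy.
now rewrite !testbit_of_nat, Nat.lxor_spec.
Qed.

Lemma of_nat_pow2 l : Z.of_nat (2 ^ l) = (2 ^ Z.of_nat l)%Z.
Proof. now rewrite Nat2Z.inj_pow. Qed.

Lemma pow2_pos l : 0 < 2 ^ l.
Proof. pose proof (Nat.pow_nonzero 2 l); lia. Qed.

Lemma lxor_lt_pow2 a b l : a < 2 ^ l -> b < 2 ^ l -> Nat.lxor a b < 2 ^ l.
Proof.
intros Ha Hb; apply Nat2Z.inj_lt; rewrite of_nat_lxor, of_nat_pow2.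
apply Nat2Z.inj_lt in Ha, Hb; rewrite of_nat_pow2 in Ha, Hb.
rewrite <- (Z.mod_small (Z.of_nat a) (2 ^ Z.of_nat l)) by lia.
rewrite <- (Z.mod_small (Z.of_nat b) (2 ^ Z.of_nat l)) by lia.
rewrite <- lxor_mod_pow2; apply Z.mod_pos_bound; lia.
Qed.

(** [(-i-1) mod q], without negative numbers. *)
Definition coresidue (q i : nat) : nat := q - 1 - i mod q.

Lemma coresidue_lt q i : 0 < q -> coresidue q i < q.
Proof. unfold coresidue; lia. Qed.

Lemma of_nat_coresidue q i : 0 < q ->
  Z.of_nat (coresidue q i) = ((- Z.of_nat i - 1) mod Z.of_nat q)%Z.
Proof.
intros Hq; unfold coresidue.
pose proof (Nat.div_mod i q); pose proof (Nat.mod_upper_bound i q).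
(* The quotient comes from [-i-1 = q * (-(i/q) - 1) + (q - 1 - i mod q)]. *)
apply Z.mod_unique_pos with (q := (- Z.of_nat (i / q) - 1)%Z); nia.
Qed.

Lemma coresidue_inj q i i' : 0 < q ->
  i / q = i' / q -> coresidue q i = coresidue q i' -> i = i'.
Proof.
unfold coresidue; intros Hq E E'.
rewrite (Nat.div_mod i q), (Nat.div_mod i' q) by lia.
pose proof (Nat.mod_upper_bound i q); pose proof (Nat.mod_upper_bound i' q); lia.
Qed.

Lemma coresidue_surj q n a : a < q ->
  exists i, i / q = n /\ coresidue q i = a.
Proof.
intros Ha; exists (q * n + (q - 1 - a)); unfold coresidue.
rewrite (Nat.mul_comm q n), Nat.div_add_l, (Nat.add_comm (n * q)), Nat.Div0.mod_add by lia.
rewrite Nat.div_small, Nat.mod_small by lia; lia.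
Qed.

(** Complementing reverses the order inside a block, so advancing the index there is lowering a Nim
    heap of size [coresidue q i]. *)
Lemma coresidue_lower q i a : 0 < q -> a < coresidue q i ->
  exists i', i < i' /\ i' / q = i / q /\ coresidue q i' = a.
Proof.
intros Hq Ha; pose proof (coresidue_lt q i Hq).
destruct (coresidue_surj q (i / q) a ltac:(lia)) as (i' & E & E').
exists i'; repeat split; auto.
rewrite (Nat.div_mod i q), (Nat.div_mod i' q), E by lia.
unfold coresidue in *; lia.
Qed.

(** * The closed form and its mex property *)

Definition rook_value (l k i j : nat) : nat :=
  2 ^ l * (k - 1 - i / 2 ^ l - j / 2 ^ l) +
  Nat.lxor (coresidue (2 ^ l) i) (coresidue (2 ^ l) j).

Lemma rook_value_sym l k i j : rook_value l k i j = rook_value l k j i.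
Proof. unfold rook_value; rewrite Nat.lxor_comm; do 2 f_equal; lia. Qed.

Lemma lxor_coresidue_lt l i j :
  Nat.lxor (coresidue (2 ^ l) i) (coresidue (2 ^ l) j) < 2 ^ l.
Proof. apply lxor_lt_pow2; apply coresidue_lt, pow2_pos. Qed.

(** Division by [2^l] recovers the level and the XOR; with [i] fixed, these give the block of [j]
    and its coresidue. *)
Lemma rook_value_column_inj l k i j j' :
  i / 2 ^ l + j / 2 ^ l < k -> i / 2 ^ l + j' / 2 ^ l < k ->
  rook_value l k i j = rook_value l k i j' -> j = j'.
Proof.
intros H H' E.
apply Nat.div_mod_unique in E as [E1 E2]; [|apply lxor_coresidue_lt..].
apply (f_equal (Nat.lxor (coresidue (2 ^ l) i))) in E2.
rewrite !lxor_cancel in E2.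
apply (coresidue_inj (2 ^ l)); auto using pow2_pos; lia.
Qed.

Lemma rook_value_column_surj l k i t u :
  t + i / 2 ^ l < k -> u < 2 ^ l ->
  exists j, i / 2 ^ l + j / 2 ^ l + t + 1 = k /\
    rook_value l k i j = 2 ^ l * t + u.
Proof.
intros Ht Hu.
(* The level [t] forces the block of [j]; the chosen coresidue cancels that of [i] under XOR and
   leaves [u]. *)
destruct (coresidue_surj (2 ^ l) (k - 1 - t - i / 2 ^ l)
            (Nat.lxor (coresidue (2 ^ l) i) u)) as (j & E & E').
{ apply lxor_lt_pow2; [apply coresidue_lt, pow2_pos|easy]. }
exists j; split; [lia|]; unfold rook_value.
rewrite E', lxor_cancel; do 2 f_equal; lia.
Qed.

Lemma rook_value_lower l k i j g :
  i / 2 ^ l + j / 2 ^ l < k -> g < rook_value l k i j ->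
  exists i' j', i' / 2 ^ l + j' / 2 ^ l < k /\
    (i < i' /\ j' = j \/ i' = i /\ j < j') /\ rook_value l k i' j' = g.
Proof.
intros H Hg; pose proof (pow2_pos l) as Hq.
pose proof (Nat.div_mod g (2 ^ l) ltac:(lia)) as Eg.
pose proof (Nat.mod_upper_bound g (2 ^ l) ltac:(lia)) as Hu.
pose proof (lxor_coresidue_lt l i j) as Hv.
set (t := g / 2 ^ l) in *; set (u := g mod 2 ^ l) in *.
(* A target of lower level is reached by leaving the block along [j]; one of equal level is reached
   inside the block by a Nim move. *)
destruct (Nat.lt_ge_cases t (k - 1 - i / 2 ^ l - j / 2 ^ l)) as [L|L].
- destruct (rook_value_column_surj l k i t u) as (j' & E & E'); [lia|easy|].
  exists i, j'; split; [lia|]; split; [right|lia].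
  split; auto; apply Nat.nle_gt; intros Hj.
  pose proof (Nat.Div0.div_le_mono _ _ (2 ^ l) Hj); lia.
- unfold rook_value in Hg.
  assert (t = k - 1 - i / 2 ^ l - j / 2 ^ l) as Et by nia.
  rewrite Eg, Et in Hg |- *; apply Nat.add_lt_mono_l in Hg.
  destruct (lt_lxor_cases _ _ _ Hg) as [L'|L'].
  + destruct (coresidue_lower _ _ _ Hq L') as (i' & Hi & E & E').
    exists i', j; split; [lia|]; split; [now left|]; unfold rook_value.
    now rewrite E, E', Nat.lxor_assoc, Nat.lxor_nilpotent, Nat.lxor_0_r.
  + destruct (coresidue_lower _ _ _ Hq L') as (j' & Hj & E & E').
    exists i, j'; split; [lia|]; split; [now right|]; unfold rook_value.
    now rewrite E, E', lxor_cancel.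
Qed.

Lemma SG_cut_staircase l k i j : i / 2 ^ l + j / 2 ^ l < k ->
  SG (cut (staircase k (2 ^ l) (2 ^ l)) i j) = rook_value l k i j.
Proof.
pose proof (pow2_pos l) as Hq.
remember (cut (staircase k (2 ^ l) (2 ^ l)) i j) as mu eqn:Emu.
(* Every move decreases this measure. *)
remember (length mu + list_sum mu) as w eqn:Ew.
revert i j mu Emu Ew; induction w as [w IH] using lt_wf_ind.
intros i j mu -> -> H.
apply (mex_unique _ _ _ (SG_mex _)); split.
- intros (nu & Hm & E).
  pose proof (rook_move_lt _ _ Hm) as Lt.
  apply rook_move_cut_staircase in Hm as (i' & j' & -> & H' & C); [|easy].
  rewrite (IH _ Lt i' j' _ eq_refl eq_refl H') in E.
  destruct C as [[L ->]|[-> L]].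
  (* Symmetry in the two indices turns a change of [i] into a change of [j], so the same injectivity
     applies. *)
  + rewrite (rook_value_sym l k i'), (rook_value_sym l k i) in E.
    apply rook_value_column_inj in E; lia.
  + apply rook_value_column_inj in E; lia.
- intros g Hg.
  destruct (rook_value_lower l k i j g H Hg) as (i' & j' & H' & C & E).
  assert (Hm : rook_move (cut (staircase k (2 ^ l) (2 ^ l)) i j)
                 (cut (staircase k (2 ^ l) (2 ^ l)) i' j')).
  { apply rook_move_cut_staircase; [easy|]; now exists i', j'. }
  exists (cut (staircase k (2 ^ l) (2 ^ l)) i' j'); split; [easy|].
  rewrite <- E; eapply (IH _ (rook_move_lt _ _ Hm)); eauto.
Qed.

(** * Passage to integers and the sets of values on a level *)

Lemma level_div l k i j : level l k i j =
  (Z.of_nat k - 1 - Z.of_nat (i / 2 ^ l) - Z.of_nat (j / 2 ^ l))%Z.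
Proof. unfold level; now rewrite !Nat2Z.inj_div, of_nat_pow2. Qed.

Lemma of_nat_rook_value l k i j : i / 2 ^ l + j / 2 ^ l < k ->
  Z.of_nat (rook_value l k i j) =
    (2 ^ Z.of_nat l * level l k i j +
     Z.lxor (- Z.of_nat i - 1) (- Z.of_nat j - 1) mod 2 ^ Z.of_nat l)%Z.
Proof.
intros H; unfold rook_value.
rewrite level_div, lxor_mod_pow2, <- of_nat_pow2.
rewrite <- !of_nat_coresidue by apply pow2_pos; rewrite <- of_nat_lxor.
rewrite Nat2Z.inj_add, Nat2Z.inj_mul; do 2 f_equal; lia.
Qed.

(** XOR with the coresidue of [i] permutes the residues, so the positions of level [t] fill a whole
    interval of length [2^l]. *)
Lemma level_values_iff l k i t g : t + i / 2 ^ l < k ->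
  level_values l k i t g <-> 2 ^ l * t <= g < 2 ^ l * (t + 1).
Proof.
intros Ht; unfold level_values; split.
- intros (j & Hj & <-); rewrite level_div in Hj.
  rewrite SG_cut_staircase by lia; unfold rook_value.
  pose proof (lxor_coresidue_lt l i j).
  replace (k - 1 - i / 2 ^ l - j / 2 ^ l) with t by lia; lia.
- intros Hg.
  destruct (rook_value_column_surj l k i t (g - 2 ^ l * t)) as (j & E & E'); [lia..|].
  exists j; rewrite level_div, SG_cut_staircase by lia; lia.
Qed.

Theorem proposition3p19 :
  forall l k : nat, (0 < l)%nat -> (0 < k)%nat ->
  (forall i j : nat,
     (0 <= Z.of_nat i / 2 ^ Z.of_nat l + Z.of_nat j / 2 ^ Z.of_nat l
        <= Z.of_nat k - 1)%Z ->
     Z.of_nat (SG (cut (staircase k (2 ^ l) (2 ^ l)) i j)) =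
       (2 ^ Z.of_nat l * level l k i j +
        Z.lxor (- Z.of_nat i - 1) (- Z.of_nat j - 1) mod 2 ^ Z.of_nat l)%Z)
  /\
  (forall tau i : nat,
     (tau <= k - 1)%nat -> (i <= (k - tau) * 2 ^ l - 1)%nat ->
     (forall g : nat, level_values l k i tau g <->
        (tau * 2 ^ l <= g <= (tau + 1) * 2 ^ l - 1)%nat)
     /\
     (forall g : nat,
        (exists t : nat, (0 <= t <= tau)%nat /\ level_values l k i t g) <->
        (0 <= g <= (tau + 1) * 2 ^ l - 1)%nat)).
Proof.
intros l k _ Hk; pose proof (pow2_pos l) as Hq; split.
- intros i j H; rewrite <- of_nat_pow2, <- !Nat2Z.inj_div in H.
  rewrite SG_cut_staircase by lia; apply of_nat_rook_value; lia.
- intros tau i Htau Hi.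
  (* This bound makes [level_values_iff] available for every [t <= tau]. *)
  assert (Hd : i / 2 ^ l < k - tau) by (apply Nat.Div0.div_lt_upper_bound; nia).
  split; intros g.
  + rewrite level_values_iff by lia; nia.
  + split.
    * intros (t & Ht & H); apply level_values_iff in H; [nia|lia].
    (* The intervals of the levels tile an initial segment, and the quotient of [g] names the one
       containing it. *)
    * intros Hg; exists (g / 2 ^ l).
      pose proof (Nat.div_mod g (2 ^ l) ltac:(lia)).
      pose proof (Nat.mod_upper_bound g (2 ^ l) ltac:(lia)).
      assert (g / 2 ^ l < tau + 1) by (apply Nat.Div0.div_lt_upper_bound; nia).
      split; [lia|]; apply level_values_iff; nia.
Qed.
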